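(* Let $G$ be a finite group, and let $\mu_1, \mu_2, \dots, \mu_n$ be probability measures on $G$. For each subgroup $H$ of $G$, let $I_H = \{i \in \{1,\dots,n\} \mid H = \langle \operatorname{supp} \mu_i\rangle\}$. Let $\mathcal{S}$ be a finite set of normal subgroups of $G$ such that $G = \left\langle \bigcup_{H \in \mathcal{S}} H\right\rangle$. Write $\nu_n = \mu_1 * \dots * \mu_n$. For each $i$, let $\sigma_i$ be the second-largest singular value of the convolution operator $*\mu_i$ as an operator on $L^2(\langle \operatorname{supp} \mu_i \rangle)$. Let $\pi$ be the uniform distribution on $G$. If $I_H$ is nonempty for each $H \in \mathcal{S}$, then \[ \|\nu_n - \pi\|_{L^2} \leq \sum_{H \in \mathcal{S}} \left(\prod_{i \in I_H} \sigma_i\right). \]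
   Context: For a finite set $S$, $L^2(S)$ is the space of real-valued functions (signed measures) on $S$ with norm $\|f\|_{L^2}^2 = \sum_{s\in S}|f(s)|^2$. For a finite group $G$ and $\mu,\nu\in L^2(G)$, the convolution is $(\mu*\nu)(g) = \sum_{h\in G}\mu(h)\nu(h^{-1}g)$, and $*\mu$ denotes the linear operator $\nu\mapsto \nu*\mu$ on $L^2(G)$. A probability measure supported in a subgroup $K$ is also viewed as an element of $L^2(K)$, with convolution operator on $L^2(K)$. The uniform distribution is $\pi(g)=1/|G|$. $\langle T\rangle$ denotes the subgroup generated by $T$. The second-largest singular value is taken counting multiplicity (e.g. singular values $1,1,0$ have second-largest singular value $1$); on a one-dimensional space (trivial group) it is taken to be $0$. *)

(* Defs.v *)
From mathcomp Require Import all_boot all_order all_algebra all_fingroup.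
From mathcomp Require Import polyrcf.

Set Implicit Arguments.
Unset Strict Implicit.
Unset Printing Implicit Defensive.

Import Order.TTheory GRing.Theory Num.Theory GroupScope.
Local Open Scope ring_scope.

(* The scalars are an arbitrary real closed field R, in particular the reals. *)

Section L2.
Variables (R : rcfType) (S : finType).
Implicit Types f mu : {ffun S -> R}.

Definition L2norm f : R := Num.sqrt (\sum_s `|f s| ^+ 2).

Definition dirac (s : S) : {ffun S -> R} := [ffun t => (t == s)%:R].

Definition uniform : {ffun S -> R} := [ffun _ => #|S|%:R^-1].

Definition is_prob mu : Prop := (forall s, 0 <= mu s) /\ \sum_s mu s = 1.

Definition supp mu : {set S} := [set s | mu s != 0].

(* Row-vector convention: row i holds the image of the i-th Dirac function. As
   the Dirac functions are an orthonormal basis of L^2(S), the adjoint of a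
   linear T has the transposed matrix. Meaningful only when T is linear. *)
Definition op_mx (T : {ffun S -> R} -> {ffun S -> R}) : 'M[R]_#|S| :=
  \matrix_(i, j) T (dirac (enum_val i)) (enum_val j).

End L2.

Section SingularValues.
Variable R : rcfType.

(* The square roots of the eigenvalues of A^T A, each repeated according to its
   multiplicity as a root of the characteristic polynomial, in nonincreasing
   order. *)
Definition singular_values n (A : 'M[R]_n) : seq R :=
  let p := char_poly (A^T *m A) in
  sort >=%R (flatten [seq nseq (mup x p) (Num.sqrt x) | x <- rootsR p]).

(* 0 when n <= 1, since nth then returns its default value. *)
Definition second_singular_value n (A : 'M[R]_n) : R :=
  nth 0 (singular_values A) 1.

End SingularValues.

Section Convolution.
Variables (R : rcfType) (gT : finGroupType).
Implicit Types mu nu : {ffun gT -> R}.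

Definition conv mu nu : {ffun gT -> R} :=
  [ffun g => \sum_(h : gT) mu h * nu (h^-1 * g)%g].

Definition conv_op mu : {ffun gT -> R} -> {ffun gT -> R} :=
  fun nu => conv nu mu.

(* mu 0 * (mu 1 * (... * mu (n - 1))), with the unit of conv (the Dirac
   function at 1) as the innermost factor. *)
Definition conv_prod n (mu : 'I_n -> {ffun gT -> R}) : {ffun gT -> R} :=
  \big[conv/dirac R 1%g]_(i < n) mu i.

Definition restrict (K : {group gT}) mu : {ffun subg_of K -> R} :=
  [ffun x => mu (sgval x)].

End Convolution.

Section MeasureSubgroup.
Variables (R : rcfType) (gT : finGroupType).
Implicit Type mu : {ffun gT -> R}.

Definition supp_group mu : {group gT} := <<supp mu>>%G.

(* The group of the convolution is the subgroup generated by supp mu, viewed as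
   a finGroupType of its own. *)
Definition sigma mu : R :=
  second_singular_value (op_mx (conv_op (restrict (supp_group mu) mu))).

Definition I_ n (mu : 'I_n -> {ffun gT -> R}) (H : {group gT}) : {set 'I_n} :=
  [set i | H == supp_group (mu i)].

End MeasureSubgroup.

(* Main.v *)
From mathcomp Require Import polyrcf complex spectral sesquilinear ring.
Require Import Defs.
From mathcomp Require Import all_boot all_order all_algebra all_fingroup.
Import Order.TTheory GRing.Theory Num.Theory GroupScope.
Local Open Scope ring_scope.

Set Implicit Arguments.
Unset Strict Implicit.
Unset Printing Implicit Defensive.

(** Let [u_H] be the uniform distribution on [H]. It is central for convolution
    when [H] is normal, and the convolution of all the [u_H], [H] in [S], is
    invariant under every [H] in [S], hence equal to [pi]. Replacing [nu_n] by
    [nu_n * u_H] for one [H] after the other thus leads from [nu_n] to [pi], and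
    as convolution operators are contractions,
    [|nu_n - pi| <= \sum_H |nu_n - nu_n * u_H|].
    Here [nu_n - nu_n * u_H = (dirac - u_H) * mu_1 * ... * mu_n], where
    [|dirac - u_H| <= 1] and all partial products have zero sum on each coset of
    [H]. On such functions [* mu_i], for [i] in [I_H], acts coset by coset as on
    the orthogonal of the constants in [L^2(H)], where its norm is at most
    [sigma_i], since the constants are fixed by the operator and its adjoint and
    realise the largest singular value [1]. *)

(** * Characteristic polynomials and root multiplicities *)

Lemma char_poly_conj (F : fieldType) n (P D : 'M[F]_n) :
  P \in unitmx -> char_poly (invmx P *m D *m P) = char_poly D.
Proof.
move=> Pu; rewrite /char_poly.
have -> : char_poly_mx (invmx P *m D *m P) =
    map_mx polyC (invmx P) *m char_poly_mx D *m map_mx polyC P.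
  rewrite /char_poly_mx mulmxBr mulmxBl !map_mxM /=; congr (_ - _).
  by rewrite -mulmxA -scalar_mxC mulmxA -map_mxM mulVmx // map_mx1 mul1mx.
rewrite !det_mulmx mulrAC -det_mulmx -map_mxM mulVmx // map_mx1 det1.
by rewrite mul1r.
Qed.

Lemma mup_prod_XsubC (F : fieldType) (I : finType) (d : I -> F) x :
  mup x (\prod_i ('X - (d i)%:P)) = count_mem x [seq d i | i : I].
Proof.
have dE r : mup x (\prod_(i <- r) ('X - (d i)%:P)) =
  count_mem x [seq d i | i <- r].
  elim: r => [|i r IHr]; first by rewrite big_nil mupNroot // root1.
  rewrite big_cons mupM ?polyXsubC_eq0 //.
    by rewrite -['X - _]expr1 mup_XsubCX IHr /=; case: eqVneq.
  exact/monic_neq0/monic_prod_XsubC.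
by rewrite -dE big_enum.
Qed.

(** * Singular values of real square matrices *)

Section Spectral.
Local Open Scope sesquilinear_scope.

Lemma mulmx_trmxC (C : numClosedFieldType) n (x y : 'rV[C]_n) :
  (x *m y^t*) 0 0 = \sum_i x 0 i * Num.conj (y 0 i).
Proof. by rewrite mxE; apply: eq_bigr => i _; rewrite !mxE. Qed.

Lemma mulmx_diag_trmxC (C : numClosedFieldType) n (d : 'I_n -> C)
    (x : 'rV[C]_n) :
  (x *m diag_mx (\row_i d i) *m x^t*) 0 0 = \sum_i d i * `|x 0 i| ^+ 2.
Proof.
rewrite mul_mx_diag mxE; apply: eq_bigr => i _.
by rewrite !mxE normCK mulrAC mulrC.
Qed.

Variable R : rcfType.

(** Each [x] occurs [mup x p] times on both sides. Occurrences are compared before [Num.sqrt] is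
    applied, since it is not injective on negative numbers. *)
Lemma singular_values_perm n (A : 'M[R]_n) (d : 'I_n -> R) :
  char_poly (A^T *m A) = \prod_i ('X - (d i)%:P) ->
  perm_eq (singular_values A) [seq Num.sqrt (d i) | i : 'I_n].
Proof.
move=> Ad; rewrite /singular_values Ad perm_sort.
set p := \prod_i _; have p0 : p != 0.
  exact/monic_neq0/monic_prod_XsubC.
have -> : flatten [seq nseq (mup x p) (Num.sqrt x) | x <- rootsR p] =
  map Num.sqrt (flatten [seq nseq (mup x p) x | x <- rootsR p]).
  by rewrite map_flatten -map_comp; congr flatten; apply: eq_map => x /=;
    rewrite map_nseq.
rewrite [X in perm_eq _ X](map_comp Num.sqrt d); apply: perm_map.
apply/allP => x _ /=; rewrite -mup_prod_XsubC -/p count_flatten -map_comp.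
have pE y : y \in rootsR p = root p y.
  have := roots_on_rootsR p0 y; rewrite in_itv /= => <-//.
(* Only the block of [x] itself contains [x]. *)
rewrite (eq_map (g := fun y => if y == x then mup x p else 0%N)); last first.
  by move=> y /=; rewrite count_nseq /=; case: eqVneq => [->|];
    rewrite (mul1n, mul0n).
rewrite sumnE big_map -big_mkcond /=.
have [xp|] := boolP (x \in rootsR p).
  rewrite big_mkcond (bigD1_seq x) ?polyrcf.uniq_roots //= eqxx.
  rewrite big1 ?addn0 // => y.
  by case: eqVneq.
move=> xp; rewrite big_seq_cond big1 => [|y /andP[yp /eqP yx]]; last first.
  by rewrite -yx yp in xp.
by rewrite mupNroot // -pE.
Qed.

(** In a nonincreasing list only the head can exceed the entry of index 1; if that entry is the
    default 0, the tail is empty. *)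
Lemma count_second_singular_value n (A : 'M[R]_n) (d : 'I_n -> R) :
  char_poly (A^T *m A) = \prod_i ('X - (d i)%:P) ->
  (#|[set i | (second_singular_value A < Num.sqrt (d i))%R]| <= 1)%N.
Proof.
move=> /singular_values_perm dA.
set t := second_singular_value A.
have -> : #|[set i | (t < Num.sqrt (d i))%R]| =
  count (> t)%R (singular_values A).
  rewrite (seq.permP dA) count_map enumT cardsE cardE size_filter.
  exact: eq_count.
have : sorted >=%R (singular_values A) by exact: sort_sorted ge_total _.
rewrite {}/t /second_singular_value; case: (singular_values A) => [|x s] //= xs.
have /allP sP : all (fun y => y <= nth 0 s 0) s.
  case: s xs => [|y s] //= /andP[_]; rewrite lexx /= => /order_path_min; apply.
  by move=> a b c /= ba /le_trans; apply.
rewrite (eq_in_count (a2 := pred0)) ?count_pred0 ?addn0 ?leq_b1 // => y /sP /=.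
by move=> ys; rewrite ltNge ys.
Qed.

Lemma singular_values_ge0 n (A : 'M[R]_n) : all (>= 0) (singular_values A).
Proof.
rewrite all_sort; apply/allP => x /flattenP[_ /mapP[y _ ->]].
by rewrite mem_nseq => /andP[_ /eqP->]; exact: sqrtr_ge0.
Qed.

Lemma second_singular_value_ge0 n (A : 'M[R]_n) : 0 <= second_singular_value A.
Proof.
rewrite /second_singular_value; case: (ltnP 1 (size (singular_values A))).
  by move=> ?; apply: (allP (singular_values_ge0 A)); exact: mem_nth.
by move=> ?; rewrite nth_default.
Qed.

Local Notation toC := (map_mx (real_complex R)).

(** Over [R[i]] the matrix is Hermitian, so it is unitarily diagonalisable with real spectrum, and
    taking real parts of the eigenvalues loses nothing. The eigenbasis [P] may stay complex, as only
    norms of coordinates are used later. *)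
Lemma symmetric_spectral n (M : 'M[R]_n) : M^T = M ->
  exists (d : 'I_n -> R) (P : 'M[R[i]]_n),
    [/\ P \is unitarymx, char_poly M = \prod_i ('X - (d i)%:P) &
        toC M = invmx P *m diag_mx (\row_i (d i)%:C%C) *m P].
Proof.
move=> Msym.
have Mherm : toC M \is hermsymmx.
  apply: realsym_hermsym.
    by apply/is_hermitianmxP; rewrite expr0 scale1r map_mx_id // map_trmx Msym.
  by apply/mxOverP => i j; rewrite mxE; apply/complex_realP; exists (M i j).
exists (fun i => complex.Re (spectral_diag (toC M) 0 i)), (spectralmx (toC M)).
have dE : (\row_i (complex.Re (spectral_diag (toC M) 0 i))%:C%C) =
  spectral_diag (toC M).
  apply/rowP => i; rewrite mxE RRe_real //.
  exact: (mxOverP (hermitian_spectral_diag_real Mherm)).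
have /orthomx_spectralP ME := hermitian_normalmx Mherm.
split; [exact: spectral_unitarymx | | by rewrite dE].
apply: (map_poly_inj (real_complex R));
  rewrite map_char_poly [X in char_poly X]ME.
rewrite char_poly_conj ?spectral_unit // char_poly_trig ?diag_mx_is_trig //.
rewrite rmorph_prod /=; apply: eq_bigr => i _.
rewrite rmorphB /= map_polyX map_polyC /= !mxE eqxx mulr1n.
by rewrite -[in LHS]dE mxE.
Qed.

Definition sqnorm n (v : 'rV[R]_n) : R := (v *m v^T) 0 0.

Lemma sqnormE n (v : 'rV[R]_n) : sqnorm v = \sum_i v 0 i ^+ 2.
Proof. by rewrite /sqnorm mxE; apply: eq_bigr => i _; rewrite mxE expr2. Qed.

Lemma sqnorm_ge0 n (v : 'rV[R]_n) : 0 <= sqnorm v.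
Proof. by rewrite sqnormE; apply: sumr_ge0 => i _; exact: sqr_ge0. Qed.

Lemma sqnorm_gt0 n (v : 'rV[R]_n) : v != 0 -> 0 < sqnorm v.
Proof.
move=> v0; rewrite lt_def sqnorm_ge0 andbT; apply: contraNneq v0.
rewrite sqnormE => /eqP; rewrite psumr_eq0 => [/allP vi0|i _];
  last exact: sqr_ge0.
apply/eqP/rowP => i; apply/eqP.
by have := vi0 i (mem_index_enum i); rewrite /= sqrf_eq0 mxE.
Qed.

(** An eigenvector [w] for [a] satisfies |w A^T|^2 = a |w|^2. *)
Lemma eigenvalue_gram_itv n (A : 'M[R]_n) a :
  (forall w : 'rV_n, sqnorm (w *m A^T) <= sqnorm w) ->
  root (char_poly (A^T *m A)) a -> 0 <= a <= 1.
Proof.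
move=> Acontr; rewrite -eigenvalue_root_char => /eigenvalueP[w wM w0].
have wA : sqnorm (w *m A^T) = a * sqnorm w.
  by rewrite /sqnorm trmx_mul trmxK mulmxA -(mulmxA w) wM -scalemxAl mxE.
have := sqnorm_ge0 (w *m A^T); have := Acontr w.
by rewrite wA ger_pMl ?pmulr_lge0 ?sqnorm_gt0 // => -> ->.
Qed.

(** In an orthonormal eigenbasis of A^T A, |v A^T|^2 is the sum of the d_i |v_i|^2, so it suffices
    to bound d_i where v_i is nonzero. Row vectors make A^T, not A, the matrix controlled by this
    Gram matrix. *)
Lemma second_singular_value_trmx n (A : 'M[R]_n) (u v : 'rV[R]_n) :
  (forall w : 'rV_n, sqnorm (w *m A^T) <= sqnorm w) ->
  u != 0 -> u *m (A^T *m A) = u -> v *m u^T = 0 ->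
  sqnorm (v *m A^T) <= second_singular_value A ^+ 2 * sqnorm v.
Proof.
move=> Acontr u0 uM vu; set t := second_singular_value A.
have t0 : 0 <= t := second_singular_value_ge0 A.
have [|d [P [Pu Ad ME]]] := @symmetric_spectral n (A^T *m A).
  by rewrite trmx_mul trmxK.
have Punit := unitarymx_unit Pu.
have d01 i : 0 <= d i <= 1.
  apply: (eigenvalue_gram_itv Acontr); rewrite Ad rootE horner_prod.
  by rewrite (bigD1 i) //= hornerXsubC subrr mul0r.
(* Coordinates of [x] in the eigenbasis formed by the rows of [P]. *)
pose co (x : 'rV[R]_n) := toC x *m invmx P.
have coT x : toC x^T = P^t* *m (co x)^t*.
  rewrite trmx_mul map_mxM mulmxA invmx_unitary // trmxCK -(invmx_unitary Pu).
  rewrite mulVmx // mul1mx; apply/matrixP => i j; rewrite !mxE.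
  by apply/esym/CrealP/complex_realP; eexists.
have dot x y : toC (x *m y^T) = co x *m (co y)^t*.
  by rewrite map_mxM coT mulmxA -invmx_unitary.
have dotM x : toC (x *m A^T *m (x *m A^T)^T) =
    co x *m diag_mx (\row_i (d i)%:C%C) *m (co x)^t*.
  rewrite trmx_mul trmxK !mulmxA -(mulmxA x) [LHS]map_mxM coT map_mxM ME.
  by rewrite !mulmxA -(invmx_unitary Pu) mulmxK.
(* As [u] is fixed, its coordinates vanish wherever the eigenvalue is not 1. *)
have wd i : co u 0 i * (d i)%:C%C = co u 0 i.
  have /rowP/(_ i) : co u *m diag_mx (\row_i (d i)%:C%C) = co u.
    by rewrite -{2}[u]uM /co map_mxM ME !mulmxA mulmxK.
  by rewrite mul_mx_diag !mxE.
(* If d i > t ^ 2 for some i, then i is the only such index, so the fixed vector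
   u, whose eigenvalue 1 is maximal, spans the i-th eigenline; hence v has no
   component along it. *)
have dle i : co v 0 i != 0 -> d i <= t ^+ 2.
  move=> vi0; have /andP[di0 di1] := d01 i.
  rewrite -(sqr_sqrtr di0) ler_sqr ?nnegrE ?sqrtr_ge0 // leNgt.
  apply/negP => tdi.
  have wj j : j != i -> co u 0 j = 0.
    move=> ji; apply: contraNeq ji => uj0.
    have dj : d j = 1 by apply: complexI; apply: (mulfI uj0); rewrite wd mulr1.
    apply/eqP; have /card_le1_eqP inj := count_second_singular_value Ad.
    apply: inj; rewrite inE //.
    by rewrite dj; apply: lt_le_trans tdi _; exact: ler_wsqrtr.
  have /rowP/(_ 0) := dot v u; rewrite vu map_mx0 mxE mulmx_trmxC.
  rewrite (bigD1 i) //= big1 => [|j ji]; last by rewrite wj // rmorph0 mulr0.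
  rewrite addr0 => /esym/eqP;
    rewrite mulf_eq0 (negPf vi0) conjC_eq0 /= => /eqP ui.
  have: toC u = 0.
    rewrite -[LHS](mulmxKV Punit) -/(co u).
    suff -> : co u = 0 by rewrite mul0mx.
    by apply/rowP => j; rewrite [RHS]mxE; case: (eqVneq j i) => [->|/wj].
  by move=> /eqP; rewrite map_mx_eq0 (negPf u0).
rewrite -lecR rmorphM /=.
have -> : (sqnorm (v *m A^T))%:C%C = \sum_i (d i)%:C%C * `|co v 0 i| ^+ 2.
  have /rowP/(_ 0) := dotM v; rewrite mxE => ->.
  exact: mulmx_diag_trmxC.
have -> : (sqnorm v)%:C%C = \sum_i `|co v 0 i| ^+ 2.
  have /rowP/(_ 0) := dot v v; rewrite mxE => ->.
  by rewrite mulmx_trmxC; apply: eq_bigr => i _; rewrite normCK.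
rewrite mulr_sumr; apply: ler_sum => i _.
have [->|vi0] := eqVneq (co v 0 i) 0; first by rewrite normr0 expr0n !mulr0.
by rewrite ler_wpM2r ?exprn_ge0 // lecR dle.
Qed.

(** Cauchy-Schwarz, from |Y x - C y|^2 = Y (X Y - C^2) with X = |x|^2, Y = |y|^2 and C = <x,y>. *)
Lemma dot_sqr_le n (x y : 'rV[R]_n) :
  (x *m y^T) 0 0 ^+ 2 <= sqnorm x * sqnorm y.
Proof.
have [->|y0] := eqVneq y 0.
  by rewrite trmx0 mulmx0 /sqnorm mul0mx !mxE expr0n mulr0.
have := sqnorm_ge0 (sqnorm y *: x - (x *m y^T) 0 0 *: y).
have yx : (y *m x^T) 0 0 = (x *m y^T) 0 0.
  by rewrite -[y in LHS]trmxK -trmx_mul mxE.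
rewrite {1}/sqnorm [(_ - _)^T]raddfB /= mulmxBl !mulmxBr.
rewrite ![(_ *: _)^T]linearZ /= -!scalemxAl -!scalemxAr.
have := sqnorm_gt0 y0; rewrite /sqnorm.
move: (x *m x^T) (x *m y^T) (y *m x^T) (y *m y^T) yx => X C C' Y CC' Y0.
rewrite !mxE CC'.
set e := (X in 0 <= X); have -> : e = Y 0 0 * (X 0 0 * Y 0 0 - C 0 0 ^+ 2).
  by rewrite {}/e; ring.
by rewrite pmulr_rge0 // subr_ge0.
Qed.

(* Applies the bound for A^T to the vector v A, which is again orthogonal to u:
   |v A|^4 = <v A A^T, v>^2 <= |v A A^T|^2 |v|^2 <= sigma_2^2 |v A|^2 |v|^2. *)
Lemma second_singular_value_bound n (A : 'M[R]_n) (u v : 'rV[R]_n) :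
  (forall w : 'rV_n, sqnorm (w *m A^T) <= sqnorm w) ->
  u != 0 -> u *m A = u -> u *m A^T = u -> v *m u^T = 0 ->
  sqnorm (v *m A) <= second_singular_value A ^+ 2 * sqnorm v.
Proof.
move=> Acontr u0 uA uAT vu.
have [->|vA0] := eqVneq (v *m A) 0.
  by rewrite {1}/sqnorm mul0mx mxE mulr_ge0 ?sqr_ge0 ?sqnorm_ge0.
have vAu : v *m A *m u^T = 0.
  by rewrite -mulmxA -[A]trmxK -trmx_mul uAT.
have := dot_sqr_le (v *m A *m A^T) v.
have -> : v *m A *m A^T *m v^T = v *m A *m (v *m A)^T.
  by rewrite trmx_mul mulmxA.
rewrite -/(sqnorm (v *m A)) => sq.
have uM : u *m (A^T *m A) = u by rewrite mulmxA uAT.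
have vAA := second_singular_value_trmx Acontr u0 uM vAu.
have := le_trans sq (ler_wpM2r (sqnorm_ge0 v) vAA).
(* Cancels one factor |v A|^2, positive because [v *m A] is nonzero here. *)
by rewrite expr2 mulrAC ler_pM2r ?sqnorm_gt0.
Qed.

End Spectral.

(** * The L2 norm and its row-vector form *)

Section L2.
Variables (R : rcfType) (S : finType).
Implicit Types f g : {ffun S -> R}.

Definition L2sq f : R := \sum_s f s ^+ 2.

Lemma L2sq_ge0 f : 0 <= L2sq f.
Proof. by apply: sumr_ge0 => s _; exact: sqr_ge0. Qed.

Lemma L2normE f : L2norm f = Num.sqrt (L2sq f).
Proof.
by congr Num.sqrt; apply: eq_bigr => s _; rewrite real_normK ?num_real.
Qed.

Lemma L2norm_ge0 f : 0 <= L2norm f. Proof. exact: sqrtr_ge0. Qed.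

Lemma sqr_L2norm f : L2norm f ^+ 2 = L2sq f.
Proof. by rewrite L2normE sqr_sqrtr ?L2sq_ge0. Qed.

Lemma L2norm_le f (c : R) : 0 <= c -> L2sq f <= c ^+ 2 -> L2norm f <= c.
Proof.
by move=> c0 fc; rewrite L2normE -[leRHS](ger0_norm c0) -sqrtr_sqr ler_wsqrtr.
Qed.

Lemma L2norm_le_mul f g (c : R) :
  0 <= c -> L2sq f <= c ^+ 2 * L2sq g -> L2norm f <= c * L2norm g.
Proof.
move=> c0 fg; apply: L2norm_le; first by rewrite mulr_ge0 ?L2norm_ge0.
by rewrite exprMn sqr_L2norm.
Qed.

Definition rowvec f : 'rV[R]_#|S| := \row_i f (enum_val i).

Lemma sum_enum_val (F : S -> R) : \sum_(i < #|S|) F (enum_val i) = \sum_s F s.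
Proof.
by rewrite [RHS](reindex (@enum_val S S)) //; exact/onW_bij/enum_val_bij.
Qed.

Lemma mul_rowvec_tr f g : (rowvec f *m (rowvec g)^T) 0 0 = \sum_s f s * g s.
Proof.
by rewrite mxE -(sum_enum_val (fun s => f s * g s)); apply: eq_bigr => i _;
  rewrite !mxE.
Qed.

Lemma sqnorm_rowvec f : sqnorm (rowvec f) = L2sq f.
Proof.
by rewrite /sqnorm mul_rowvec_tr; apply: eq_bigr => s _; rewrite expr2.
Qed.

Lemma L2normD f g : L2norm (f + g) <= L2norm f + L2norm g.
Proof.
apply: L2norm_le; first by rewrite addr_ge0 ?L2norm_ge0.
have -> : L2sq (f + g) = L2sq f + L2sq g + (\sum_s f s * g s) *+ 2.
  rewrite /L2sq mulr2n -!big_split; apply: eq_bigr => s _ /=; rewrite ffunE;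
    ring.
rewrite sqrrD !sqr_L2norm [leRHS]addrAC lerD2l lerMn2r /=.
apply: le_trans (ler_norm _) _.
rewrite -ler_sqr ?nnegrE ?mulr_ge0 ?L2norm_ge0 // exprMn !sqr_L2norm.
by rewrite real_normK ?num_real // -mul_rowvec_tr -!sqnorm_rowvec;
  exact: dot_sqr_le.
Qed.

End L2.

(** * Doubly stochastic matrices *)

(** The difference of the two sides is the variance of [v] under the weights [a]. *)
Lemma weighted_mean_sqr_le (R : realFieldType) (I : finType) (a v : I -> R) :
  (forall i, 0 <= a i) -> \sum_i a i = 1 ->
  (\sum_i v i * a i) ^+ 2 <= \sum_i v i ^+ 2 * a i.
Proof.
move=> a0 a1; set m := \sum_i _; rewrite -subr_ge0.
have -> : \sum_i v i ^+ 2 * a i - m ^+ 2 = \sum_i a i * (v i - m) ^+ 2.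
  transitivity (\sum_i v i ^+ 2 * a i - (m *+ 2) * m + m ^+ 2 * \sum_i a i).
    by rewrite a1; ring.
  rewrite {2}/m !mulr_sumr -sumrB -big_split; apply: eq_bigr => i _ /=; ring.
by apply: sumr_ge0 => i _; rewrite mulr_ge0 ?sqr_ge0.
Qed.

(** Column sums 1 make each entry of [v *m A] a weighted mean; row sums 1 make the mean squares add
    up to |v|^2. *)
Lemma doubly_stochastic_contraction (R : rcfType) n (A : 'M[R]_n)
    (v : 'rV[R]_n) :
  (forall i j, 0 <= A i j) -> (forall i, \sum_j A i j = 1) ->
  (forall j, \sum_i A i j = 1) -> sqnorm (v *m A) <= sqnorm v.
Proof.
move=> A0 rA cA; rewrite !sqnormE.
apply: (@le_trans _ _ (\sum_j \sum_i v 0 i ^+ 2 * A i j)).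
  by apply: ler_sum => j _; rewrite mxE; exact: weighted_mean_sqr_le.
rewrite exchange_big; apply: ler_sum => i _ /=.
by rewrite -mulr_sumr rA mulr1.
Qed.

(** * Convolution and its matrix *)

Section Conv.
Variables (R : rcfType) (gT : finGroupType).
Implicit Types f g mu : {ffun gT -> R}.

Lemma sum_mull (F : gT -> R) x : \sum_y F (x * y)%g = \sum_y F y.
Proof. by rewrite [RHS](reindex_inj (mulgI x)). Qed.

Lemma sum_mulr (F : gT -> R) x : \sum_y F (y * x)%g = \sum_y F y.
Proof. by rewrite [RHS](reindex_inj (mulIg x)). Qed.

Lemma sum_inv (F : gT -> R) : \sum_y F y^-1%g = \sum_y F y.
Proof. by rewrite [RHS](reindex_inj invg_inj). Qed.

Lemma convA : associative (@conv R gT).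
Proof.
move=> f g mu; apply/ffunP => x; rewrite !ffunE.
under [RHS]eq_bigr do rewrite ffunE mulr_suml.
rewrite exchange_big; apply: eq_bigr => y _ /=; rewrite ffunE mulr_sumr.
rewrite -[RHS](sum_mull _ y); apply: eq_bigr => z _ /=.
by rewrite mulKg invMg mulgA mulrA.
Qed.

Lemma conv1f f : conv (dirac R 1%g) f = f.
Proof.
apply/ffunP => x; rewrite ffunE (bigD1 1%g) //= big1 => [|y y1].
  by rewrite addr0 ffunE eqxx mul1r invg1 mul1g.
by rewrite ffunE (negPf y1) mul0r.
Qed.

Lemma convf1 f : conv f (dirac R 1%g) = f.
Proof.
apply/ffunP => x; rewrite ffunE (bigD1 x) //= big1 => [|y yx].
  by rewrite addr0 ffunE mulVg eqxx mulr1.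
by rewrite ffunE -eq_mulVg1 (negPf yx) mulr0.
Qed.

Lemma convBl f g mu : conv (f - g) mu = conv f mu - conv g mu.
Proof.
apply/ffunP => x; rewrite !ffunE -sumrB; apply: eq_bigr => y _.
by rewrite !ffunE mulrBl.
Qed.

Lemma conv0f f : conv 0 f = 0.
Proof. by rewrite -[0 in LHS](subrr 0) convBl subrr. Qed.

Lemma sum_conv f mu : \sum_x conv f mu x = (\sum_x f x) * \sum_x mu x.
Proof.
under eq_bigr do rewrite ffunE.
rewrite exchange_big mulr_suml; apply: eq_bigr => y _ /=.
by rewrite -mulr_sumr sum_mull.
Qed.

Lemma op_mx_conv mu i j :
  op_mx (conv_op mu) i j = mu ((enum_val i)^-1 * enum_val j)%g.
Proof.
rewrite mxE ffunE (bigD1 (enum_val i)) //= big1 => [|y yi].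
  by rewrite addr0 ffunE eqxx mul1r.
by rewrite ffunE (negPf yi) mul0r.
Qed.

Lemma mul_rowvec_conv f mu :
  rowvec f *m op_mx (conv_op mu) = rowvec (conv f mu).
Proof.
apply/rowP => j; rewrite mxE [RHS]mxE ffunE.
rewrite -(sum_enum_val (fun y => f y * mu (y^-1 * enum_val j)%g)).
by apply: eq_bigr => i _; rewrite op_mx_conv mxE.
Qed.

Section Prob.
Variable mu : {ffun gT -> R}.
Hypothesis mu_prob : is_prob mu.

Lemma op_mx_conv_ge0 i j : 0 <= op_mx (conv_op mu) i j.
Proof. by rewrite op_mx_conv; case: mu_prob. Qed.

Lemma op_mx_conv_row i : \sum_j op_mx (conv_op mu) i j = 1.
Proof.
under eq_bigr do rewrite op_mx_conv.
rewrite (sum_enum_val (fun y => mu ((enum_val i)^-1 * y)%g)) sum_mull.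
by case: mu_prob.
Qed.

Lemma op_mx_conv_col j : \sum_i op_mx (conv_op mu) i j = 1.
Proof.
under eq_bigr do rewrite op_mx_conv.
rewrite (sum_enum_val (fun y => mu (y^-1 * enum_val j)%g)).
rewrite (sum_inv (fun y => mu (y * enum_val j)%g)) sum_mulr.
by case: mu_prob.
Qed.

Lemma L2sq_conv_le f : L2sq (conv f mu) <= L2sq f.
Proof.
rewrite -!sqnorm_rowvec -mul_rowvec_conv.
apply: doubly_stochastic_contraction.
- exact: op_mx_conv_ge0.
- exact: op_mx_conv_row.
- exact: op_mx_conv_col.
Qed.

Lemma L2norm_conv_le f : L2norm (conv f mu) <= L2norm f.
Proof.
rewrite -[leRHS]mul1r; apply: L2norm_le_mul => //.
by rewrite expr1n mul1r L2sq_conv_le.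
Qed.

(** The fixed vector is the constant 1: row and column sums equal to 1 say that the matrix and its
    transpose fix it, and [f] is orthogonal to it. *)
Lemma L2sq_conv_singular f : \sum_x f x = 0 ->
  L2sq (conv f mu) <= second_singular_value (op_mx (conv_op mu)) ^+ 2 * L2sq f.
Proof.
move=> f0; rewrite -!sqnorm_rowvec -mul_rowvec_conv.
apply: (@second_singular_value_bound _ _ _ (const_mx 1)).
- move=> w; apply: doubly_stochastic_contraction => [i j|i|j].
  + by rewrite mxE op_mx_conv_ge0.
  + by rewrite -[RHS](op_mx_conv_col i); apply: eq_bigr => j _; rewrite mxE.
  + by rewrite -[RHS](op_mx_conv_row j); apply: eq_bigr => i _; rewrite mxE.
- apply/negP => /eqP/rowP/(_ (enum_rank 1%g)) /eqP.
  by rewrite !mxE oner_eq0.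
- apply/rowP => j; rewrite !mxE -[RHS](op_mx_conv_col j).
  by apply: eq_bigr => i _; rewrite [const_mx _ _ _]mxE mul1r.
- apply/rowP => j; rewrite !mxE -[RHS](op_mx_conv_row j).
  by apply: eq_bigr => i _; rewrite [const_mx _ _ _]mxE mul1r mxE.
- apply/matrixP => i j; rewrite !mxE -[RHS]f0 -sum_enum_val.
  by apply: eq_bigr => k _; rewrite !mxE mulr1.
Qed.

End Prob.
End Conv.

Lemma sum_indicator (R : pzSemiRingType) (I : finType) (P : pred I) :
  \sum_i (P i)%:R = #|P|%:R :> R.
Proof.
rewrite -sum1_card natr_sum [RHS]big_mkcond; apply: eq_bigr => i _.
by rewrite unfold_in; case: (P i).
Qed.

(** * Cosets and the uniform measure of a subgroup *)

Section Subgroup.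
Variables (R : rcfType) (gT : finGroupType) (H : {group gT}).
Implicit Types f mu : {ffun gT -> R}.

Lemma sum_subg (F : gT -> R) :
  \sum_(x : subg_of H) F (sgval x) = \sum_(x in H) F x.
Proof.
rewrite [RHS](reindex_onto sgval (subg H)) => [|x]; last exact: subgK.
by apply: eq_bigl => x; rewrite subgP sgvalK eqxx.
Qed.

Lemma restrict_prob mu : supp mu \subset H -> is_prob mu ->
  is_prob (restrict H mu).
Proof.
move=> suppH [mu0 mu1]; split=> [x|]; first by rewrite ffunE.
under eq_bigr do rewrite ffunE.
rewrite sum_subg -[RHS]mu1 big_mkcond; apply: eq_bigr => x _.
case: ifPn => // xH; apply/esym/eqP; apply: contraNT xH => mux.
by apply: (subsetP suppH); rewrite inE.
Qed.

(** The restriction of [f] to the left coset gH, transported to H. *)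
Definition translate f g : {ffun subg_of H -> R} :=
  [ffun x => f (g * sgval x)%g].

(** Right convolution by a measure supported in H does not mix left cosets of H. *)
Lemma conv_translate f mu g : supp mu \subset H ->
  conv (translate f g) (restrict H mu) = translate (conv f mu) g.
Proof.
move=> suppH; apply/ffunP => x; rewrite !ffunE.
rewrite -[RHS](sum_mull _ g) /=.
under [RHS]eq_bigr do rewrite invMg -mulgA mulKg.
under eq_bigr do rewrite !ffunE /=.
rewrite (sum_subg (fun y => f (g * y)%g * mu (y^-1 * sgval x)%g)) big_mkcond.
apply: eq_bigr => y _; case: ifPn => // yH; apply/esym/eqP.
rewrite mulf_eq0 orbC; apply: contraNT yH; rewrite negb_or => /andP[yx _].
have := subsetP suppH (y^-1 * sgval x)%g; rewrite inE yx => /(_ isT).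
by rewrite groupMr ?groupV ?subgP.
Qed.

(** Each point of the group is g x for exactly |H| pairs (g, x) with x in H. *)
Lemma sum_L2sq_translate f : \sum_g L2sq (translate f g) = #|H|%:R * L2sq f.
Proof.
rewrite exchange_big /=.
under eq_bigr do under eq_bigr do rewrite ffunE.
under eq_bigr => x _ do rewrite (sum_mulr (fun y => f y ^+ 2)).
rewrite (sum_subg (fun=> L2sq f)) sumr_const.
by rewrite mulr_natl.
Qed.

Definition uniform_on : {ffun gT -> R} := [ffun x => (x \in H)%:R / #|H|%:R].

Let cardH_neq0 : #|H|%:R != 0 :> R.
Proof. by rewrite pnatr_eq0 -lt0n cardG_gt0. Qed.

Lemma sum_uniform_on : \sum_x uniform_on x = 1.
Proof.
under eq_bigr do rewrite ffunE.
by rewrite -mulr_suml sum_indicator divff.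
Qed.

Lemma uniform_on_prob : is_prob uniform_on.
Proof.
by split=> [x|]; [rewrite ffunE divr_ge0 ?ler0n | exact: sum_uniform_on].
Qed.

(** Shows that [conv f uniform_on = 0] encodes zero sum on every left coset of H. *)
Lemma conv_uniform_onE f g :
  conv f uniform_on g = (\sum_(x in H) f (g * x)%g) / #|H|%:R.
Proof.
rewrite ffunE -[LHS](sum_mull _ g) mulr_suml [RHS]big_mkcond;
  apply: eq_bigr => x _ /=.
rewrite invMg -mulgA mulVg mulg1 ffunE groupV; case: ifP => _.
  by rewrite mul1r.
by rewrite mul0r mulr0.
Qed.

Lemma uniform_on_idem : conv uniform_on uniform_on = uniform_on.
Proof.
apply/ffunP => g; rewrite conv_uniform_onE.
rewrite (eq_bigr (fun=> uniform_on g)) => [|x xH];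
  last by rewrite !ffunE groupMr.
by rewrite sumr_const -[_ *+ _ in LHS]mulr_natr mulfK.
Qed.

Lemma conv_uniform_on_mulr f g x : x \in H ->
  conv f uniform_on (g * x)%g = conv f uniform_on g.
Proof.
move=> xH; rewrite !ffunE; apply: eq_bigr => y _.
by rewrite !ffunE mulgA groupMr.
Qed.

(** The measure [uniform_on] is constant on conjugacy classes when H is normal. *)
Lemma conv_uniform_onC f : H <| [set: gT] ->
  conv f uniform_on = conv uniform_on f.
Proof.
move=> nH; apply/ffunP => g; rewrite !ffunE.
rewrite -[RHS](sum_inv (fun y => uniform_on y * f (y^-1 * g)%g)).
rewrite -[RHS](sum_mulr _ g^-1%g); apply: eq_bigr => y _.
rewrite /= invgK invMg invgK mulgKV mulrC !ffunE; congr (_ %:R / _ * _).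
have -> : (g * y^-1 = (y^-1 * g) ^ y^-1)%g.
  by rewrite /conjg invgK !mulgA mulgV mul1g.
by rewrite memJ_norm // (subsetP (normal_norm nH)) ?inE.
Qed.

(* Averaging over all translates of f replaces a choice of coset
   representatives. *)
Lemma L2norm_conv_sigma f mu : is_prob mu -> H = supp_group mu ->
  conv f uniform_on = 0 -> L2norm (conv f mu) <= sigma mu * L2norm f.
Proof.
move=> mu_prob Hmu f0; apply: L2norm_le_mul.
  exact: second_singular_value_ge0.
have suppH : supp mu \subset H by rewrite Hmu subset_gen.
rewrite -(ler_pM2l (x := #|H|%:R)) ?ltr0n ?cardG_gt0 // mulrCA
  -!sum_L2sq_translate.
rewrite mulr_sumr; apply: ler_sum => g _.
rewrite -conv_translate // /sigma -Hmu; apply: L2sq_conv_singular.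
  exact: restrict_prob.
under eq_bigr do rewrite ffunE.
rewrite (sum_subg (fun x => f (g * x)%g)).
have /ffunP/(_ g) := f0; rewrite conv_uniform_onE ffunE => /eqP.
by rewrite mulf_eq0 invr_eq0 (negPf cardH_neq0) orbF => /eqP.
Qed.

Lemma L2norm_dirac_uniform_on_le1 : L2norm (dirac R 1%g - uniform_on) <= 1.
Proof.
apply: L2norm_le => //; rewrite expr1n.
have -> : L2sq (dirac R 1%g - uniform_on) = 1 - #|H|%:R^-1.
  (* Expands the square: the cross term lives at 1, and u_H^2 = u_H / |H| pointwise. *)
  transitivity (\sum_x ((x == 1%g)%:R * (1 - 2 / #|H|%:R)
                        + uniform_on x * #|H|%:R^-1) : R).
    apply: eq_bigr => x _; rewrite !ffunE.
    case: eqVneq => [->|_]; last by case: (x \in H) => /=; ring.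
    by rewrite group1 /=; ring.
  rewrite big_split /= -!mulr_suml sum_uniform_on sum_indicator card1.
  by ring.
by rewrite gerBl invr_ge0 ler0n.
Qed.

(** Induction on the factors with [f] general: centrality of u_H preserves [conv f uniform_on = 0].
    Factors in [I_ mu H] gain [sigma], the others only contract. *)
Lemma L2norm_conv_prod_le n (mu : 'I_n -> {ffun gT -> R}) f :
  (forall i, is_prob (mu i)) -> H <| [set: gT] -> conv f uniform_on = 0 ->
  L2norm (conv f (conv_prod mu)) <=
    (\prod_(i in I_ mu H) sigma (mu i)) * L2norm f.
Proof.
move=> mu_prob nH; rewrite /conv_prod.
elim: (index_enum _) f => [|i r IHr] f f0.
  by rewrite !big_nil convf1 mul1r.
rewrite !big_cons convA.
have fi0 : conv (conv f (mu i)) uniform_on = 0.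
  by rewrite -convA conv_uniform_onC // convA f0 conv0f.
apply: le_trans (IHr _ fi0) _.
have p0 : 0 <= \prod_(j <- r | j \in I_ mu H) sigma (mu j).
  by apply: prodr_ge0 => j _; exact: second_singular_value_ge0.
case: ifPn => [|_]; last by rewrite ler_wpM2l ?L2norm_conv_le.
rewrite inE => /eqP Hi; rewrite -mulrA mulrCA ler_wpM2l //.
exact: L2norm_conv_sigma.
Qed.

End Subgroup.

(** * Successive smoothing by normal subgroups *)

Section Telescope.
Variables (R : rcfType) (gT : finGroupType).
Implicit Types (f : {ffun gT -> R}) (r : seq {group gT}).

Definition smooth f r := foldr (fun H g => conv g (uniform_on R H)) f r.

(** Adding and subtracting [conv f (uniform_on R H)] keeps each new term in the original [f]; the
    old error is convolved with u_H, which contracts it. *)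
Lemma L2norm_sub_smooth f r :
  L2norm (f - smooth f r) <= \sum_(H <- r) L2norm (f - conv f (uniform_on R H)).
Proof.
elim: r => [|H r IHr].
  rewrite big_nil subrr L2normE /L2sq big1 ?sqrtr0 // => x _.
  by rewrite ffunE expr0n.
rewrite big_cons /=.
have -> : f - conv (smooth f r) (uniform_on R H) =
    (f - conv f (uniform_on R H)) + conv (f - smooth f r) (uniform_on R H).
  by rewrite convBl addrA subrK.
apply: le_trans (L2normD _ _) _; rewrite lerD2l.
by apply: le_trans IHr; exact/L2norm_conv_le/uniform_on_prob.
Qed.

(** Later convolutions preserve right invariance: by centrality they can be done on the left, which
    commutes with right translation. *)
Lemma smooth_mulr f r (H : {group gT}) g x :
  (forall K, K \in r -> K <| [set: gT]) -> H \in r -> x \in H ->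
  smooth f r (g * x)%g = smooth f r g.
Proof.
move=> nr; elim: r nr g => [|K r IHr] //= nr g;
  rewrite inE => /orP[/eqP-> xK | Hr xH].
  exact: conv_uniform_on_mulr.
rewrite conv_uniform_onC ?nr ?mem_head // !ffunE; apply: eq_bigr => y _.
by rewrite mulgA IHr // => L Lr; rewrite nr // inE Lr orbT.
Qed.

Lemma sum_smooth f r : \sum_x smooth f r x = \sum_x f x.
Proof. by elim: r => //= H r IHr; rewrite sum_conv sum_uniform_on mulr1. Qed.

Lemma smooth_uniform f r : \sum_x f x = 1 ->
  (forall K, K \in r -> K <| [set: gT]) ->
  [set: gT] = <<\bigcup_(H in r) (H : {set gT})>> ->
  smooth f r = uniform R gT.
Proof.
move=> f1 nr gen_r.
(* The right periods form a subgroup. It contains every H in [r], hence is everything; the function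
   is then constant, and its total mass 1 determines it. *)
pose inv := [set x | [forall g, smooth f r (g * x)%g == smooth f r g]].
have inv_group : group_set inv.
  apply/group_setP; split; first by rewrite inE; apply/forallP => g;
    rewrite mulg1.
  move=> x y; rewrite !inE => /forallP fx /forallP fy; apply/forallP => g.
  by rewrite mulgA (eqP (fy _)) (eqP (fx _)).
have invT x : x \in inv.
  have : x \in <<\bigcup_(H in r) (H : {set gT})>> by rewrite -gen_r inE.
  apply: subsetP; rewrite -[inv]/(gval (Group inv_group)) gen_subG.
  apply/bigcupsP => H Hr; apply/subsetP => y yH; rewrite inE.
  by apply/forallP => g; rewrite (smooth_mulr _ _ nr Hr).
have smooth1 x : smooth f r x = smooth f r 1%g.
  by have := invT x; rewrite inE => /forallP/(_ 1%g)/eqP; rewrite mul1g.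
apply/ffunP => x; rewrite [RHS]ffunE smooth1.
have := sum_smooth f r;
  rewrite f1 (eq_bigr _ (fun x _ => smooth1 x)) sumr_const.
have gT0 : #|gT|%:R != 0 :> R.
  by rewrite pnatr_eq0 -lt0n; apply/card_gt0P; exists 1%g.
by move=> card1; apply: (mulIf gT0); rewrite mulVf // mulr_natr.
Qed.

End Telescope.

(** * Distance from the product measure to uniform *)

Theorem theorem1p1 (R : rcfType) (gT : finGroupType) (n : nat)
    (mu : 'I_n -> {ffun gT -> R})
    (mu_prob : forall i, is_prob (mu i))
    (S : {set {group gT}})
    (S_normal : forall H : {group gT}, H \in S -> H <| [set: gT])
    (S_gen : [set: gT] = <<\bigcup_(H in S) (H : {set gT})>>)
    (I_nonempty : forall H : {group gT}, H \in S -> I_ mu H != set0) :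
  L2norm (conv_prod mu - uniform R gT)
    <= \sum_(H in S) \prod_(i in I_ mu H) sigma (mu i).
Proof.
have prod1 : \sum_x conv_prod mu x = 1.
  apply: (big_ind (fun f : {ffun gT -> R} => \sum_x f x = 1)) => [|f g f1 g1|i _].
  - by under eq_bigr do rewrite ffunE; rewrite sum_indicator card1.
  - by rewrite sum_conv f1 g1 mulr1.
  - by case: (mu_prob i).
rewrite -(@smooth_uniform _ _ (conv_prod mu) (enum S)) //; first last.
- rewrite S_gen; congr <<_>>; apply: eq_bigl => H; by rewrite mem_enum.
- by move=> H; rewrite mem_enum; exact: S_normal.
apply: le_trans (L2norm_sub_smooth _ _) _; rewrite big_enum.
apply: ler_sum => H HS; have nH := S_normal _ HS.
(* Centrality moves u_H to the front, giving (dirac - u_H) * nu_n; idempotence of u_H then shows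
   that u_H annihilates dirac - u_H. *)
rewrite conv_uniform_onC // -{1}[conv_prod mu]conv1f -convBl.
apply: le_trans (L2norm_conv_prod_le mu_prob nH _) _.
  by rewrite convBl conv1f uniform_on_idem subrr.
apply: ler_piMr; last exact: L2norm_dirac_uniform_on_le1.
by apply: prodr_ge0 => i _; exact: second_singular_value_ge0.
Qed.
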